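(* For an integer $n\ge 1$, let $E(n)$ be the number of edges of the $(n,n,n)$ sort graph and let $T(n)=n\,E(n)$ be the cost (number of edges times payload size $d=n$) of the recursive breadth-first enumeration of octagonal tilings of the octagon with side lengths $a=b=c=d=n$. Then $$ T(n)=n^2\,\frac{(3n)!}{(n!)^3}\;\sim\;\frac{n\sqrt3}{2\pi}\,3^{3n}\qquad (n\to\infty), $$ where $\sim$ means that the ratio tends to $1$. Consequently, in terms of the number $N=6n^2$ of tiles of the octagonal tiling, there is a constant $\gamma>0$ such that the cost is $O\!\left(\sqrt N\,\exp(\gamma\sqrt N)\right)$.
   Context: For nonnegative integers $a,b,c$, the $(a,b,c)$ sort graph is the directed graph whose vertices are the sequences of length $a+b+c$ with exactly $a$ entries $0$, $b$ entries $1$ and $c$ entries $2$; there is an edge from $u$ to $v$ iff $v$ is obtained from $u$ by exchanging two adjacent entries $u_j<u_{j+1}$. The enumeration algorithm computes the number $\Omega(a,b,c,d)$ of tilings, by unit squares and unit $45^\circ$ rhombi, of a centro-symmetric octagon with consecutive integer side lengths $a,b,c,d$ (and $N=ac+bd+(a+c)(b+d)$ tiles). It does so by a single breadth-first pass through the $(a,b,c)$ sort graph, storing on each edge a list (the payload) of at most about $d$ counts. Its time complexity is measured as the product of the number of edges and the payload size $d$. *)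

(* Defs.v *)
From mathcomp Require Import all_boot all_order all_algebra.
From mathcomp Require Import fingroup perm.
From mathcomp Require Import all_classical all_reals all_analysis.

Set Implicit Arguments.
Unset Strict Implicit.
Unset Printing Implicit Defensive.

Local Open Scope nat_scope.

(* The vertices are kept as a set of words of length a + b + c over {0,1,2}. *)
Definition sort_vertices (a b c : nat) : {set (a + b + c).-tuple 'I_3} :=
  [set u : (a + b + c).-tuple 'I_3 |
    [&& count (fun x : 'I_3 => x == 0 :> nat) u == a,
        count (fun x : 'I_3 => x == 1 :> nat) u == b &
        count (fun x : 'I_3 => x == 2 :> nat) u == c]].

Definition sort_step (m : nat) : rel (m.-tuple 'I_3) :=
  fun u v => [exists j : 'I_m, exists k : 'I_m,
    [&& k == j.+1 :> nat, tnth u j < tnth u k &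
        v == [tuple tnth u (tperm j k i) | i < m]]].

(* Directed edges are identified with the ordered pairs (source, target); there
   are no parallel edges. *)
Definition sort_edges (a b c : nat) :
    {set (a + b + c).-tuple 'I_3 * (a + b + c).-tuple 'I_3} :=
  [set p | [&& p.1 \in sort_vertices a b c, p.2 \in sort_vertices a b c &
               sort_step p.1 p.2]].

(* Cost of the enumeration for the octagon with sides a, b, c, d: one pass
   through the edges of the (a,b,c) sort graph, with a payload of size d. *)
Definition enum_cost (a b c d : nat) : nat := d * #|sort_edges a b c|.

(* Number of tiles in a tiling of the octagon with sides a, b, c, d. *)
Definition tile_count (a b c d : nat) : nat :=
  a * c + b * d + (a + c) * (b + d).

(* Main.v *)
Require Import Defs.
From mathcomp Require Import all_boot all_order all_algebra.
From mathcomp Require Import fingroup perm.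
From mathcomp Require Import all_classical all_reals all_analysis.
From mathcomp Require Import zify ring lra.

Set Implicit Arguments.
Unset Strict Implicit.
Unset Printing Implicit Defensive.

Import Order.TTheory GRing.Theory Num.Theory.
Import numFieldNormedType.Exports.

(** Edges of the sort graph are pairs (word, adjacent ascent). By symmetry the
    number of words with letters p and q at two given positions does not depend
    on the positions, so double counting gives E(n) = n (3n)! / n!^3.

    For the asymptotics, (3n)! / n!^3 equals 27^n / (3n + 1) times the product
    of the 1 - x^2 / k^2 for 1 <= k <= n, with x = 1/3, and Euler's product for
    sin (pi x) supplies the constant. Euler's product comes from the integrals of
    cos (c t) cos^n t over [0, pi/2], with c = 2x: the recursions in n for c
    and for 0 differ by one factor of the product, and the ratio of the two
    integrals tends to 1 because cos^2 t <= cos t <= cos (c t) <= 1. *)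

Local Open Scope nat_scope.

(** * Counting words and edges *)

Section Words.
Variable k : nat.
Implicit Types (m : nat) (a : 'I_k -> nat).

Definition words m a : {set m.-tuple 'I_k} :=
  [set u : m.-tuple 'I_k | [forall x, count_mem x u == a x]].

Lemma wordsP m a (u : m.-tuple 'I_k) :
  reflect (forall x, count_mem x u = a x) (u \in words m a).
Proof. by rewrite inE; apply: (iffP 'forall_eqP). Qed.

Lemma card_cons_tuples m x (A : {set m.+1.-tuple 'I_k}) :
  #|[set u in A | thead u == x]| = #|[set v : m.-tuple 'I_k | [tuple of x :: v] \in A]|.
Proof.
rewrite -(card_imset (f := fun v : m.-tuple 'I_k => [tuple of x :: v])).
  apply: eq_card => u; rewrite inE; apply/andP/imsetP => [[uA /eqP <-]|[v]].
    exists [tuple of behead u]; last exact: tuple_eta.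
    by rewrite inE -tuple_eta.
  by rewrite inE => vA ->; rewrite theadE.
by move=> v w /(congr1 val) [] /val_inj.
Qed.

(** The guard [0 < a x] is there because subtraction truncates: without it, a letter that must not
    occur could still be put in front. *)
Lemma words_cons m a x (v : m.-tuple 'I_k) :
  ([tuple of x :: v] \in words m.+1 a) =
  (0 < a x)%N && (v \in words m (fun y => a y - (x == y))).
Proof.
apply/wordsP/andP => [h|[ax /wordsP h] y].
  split; first by rewrite -h /= eqxx.
  by apply/wordsP => y; rewrite -h /=; lia.
by rewrite /= h; case: eqVneq => [<-|]; lia.
Qed.

(** The multinomial coefficient, free of division. Induction on the length, sorting words by first
    letter: the class of [x] contributes [a x * m!], and the [a x] sum to [m + 1]. *)
Lemma card_words m a : (\sum_x a x)%N = m ->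
  (#|words m a| * \prod_x (a x)`!)%N = m`!.
Proof.
elim: m a => [|m IH] a Sa.
  have a0 x : a x = 0%N.
    by have := Sa => /eqP; rewrite sum_nat_eq0 => /forallP/(_ x)/eqP.
  rewrite big1 => [|x _]; last by rewrite a0.
  rewrite muln1 (_ : words 0 a = [set: _]%SET) ?cardsT ?card_tuple //.
  by apply/setP => u; rewrite [RHS]inE; apply/wordsP => x; rewrite tuple0 a0.
rewrite -sum1_card (partition_big (@thead _ _) predT) //= big_distrl /=.
transitivity (\sum_x (a x * m`!))%N; last by rewrite -big_distrl Sa factS.
apply: eq_bigr => x _; rewrite sum1dep_card.
rewrite (_ : #|_| = #|[set u in words m.+1 a | thead u == x]|); last first.
  by apply: eq_card => u; rewrite !inE.
rewrite card_cons_tuples.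
case: (posnP (a x)) => [ax|ax].
  rewrite (_ : [set v | _] = finset.set0) ?cards0 ?ax ?mul0n //.
  by apply/setP => v; rewrite inE words_cons ax finset.in_set0.
rewrite (_ : [set v | _] = words m (fun y => a y - (x == y))); last first.
  by apply/setP => v; rewrite inE words_cons ax.
rewrite -(IH (fun y => a y - (x == y))%N); last first.
  rewrite (bigD1 x) //= eqxx (eq_bigr a); first by move: Sa; rewrite (bigD1 x) //=; lia.
  by move=> y; rewrite eq_sym => /negPf ->; rewrite subn0.
rewrite mulnCA; congr (_ * _)%N.
rewrite (bigD1 x) //= [in RHS](bigD1 x) //= eqxx subn1 mulnA -{1 2}(prednK ax) factS.
congr (_ * _)%N; apply: eq_bigr => y.
by rewrite eq_sym => /negPf ->; rewrite subn0.
Qed.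

Lemma count_memE m (u : m.-tuple 'I_k) x :
  count_mem x u = (\sum_(i < m) (tnth u i == x))%N.
Proof. by rewrite -sum1_count big_tuple -big_mkcond. Qed.

Definition permute_tuple m (s : 'S_m) (u : m.-tuple 'I_k) :=
  [tuple tnth u (s i) | i < m].

Lemma permute_tuple_inj m (s : 'S_m) : injective (permute_tuple s).
Proof.
move=> u v uv; apply: eq_from_tnth => i.
by have := congr1 (fun w => tnth w (s^-1 i)%g) uv; rewrite !tnth_mktuple permKV.
Qed.

Lemma permute_words m (s : 'S_m) a u :
  (permute_tuple s u \in words m a) = (u \in words m a).
Proof.
rewrite !inE; apply: eq_forallb => x; rewrite !count_memE.
rewrite [in RHS](reindex_inj (@perm_inj _ s)) /=; congr (_ == _).
by apply: eq_bigr => i _; rewrite tnth_mktuple.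
Qed.

Definition words_at m a (p q : 'I_k) (i j : 'I_m) : {set m.-tuple 'I_k} :=
  [set u in words m a | (tnth u i == p) && (tnth u j == q)].

(** Permuting positions by some [s] with [s i' = i] and [s j' = j] injects the first set into the
    second. Exchanging the two pairs of positions then gives equality. *)
Lemma card_words_at_le m a p q (i j i' j' : 'I_m) : i != j -> i' != j' ->
  (#|words_at a p q i j| <= #|words_at a p q i' j'|)%N.
Proof.
move=> ij ij'.
have [s [si sj]] : exists s : 'S_m, s i' = i /\ s j' = j.
  (* [t] sends [i'] to [i]. The second transposition sends [t j'] to [j] and fixes [i], which
     differs from [j] and, by injectivity of [t], from [t j']. *)
  pose t := tperm i' i; exists (t * tperm (t j') j)%g; rewrite !permM tpermL.
  split; last by rewrite tpermL.
  by rewrite tpermD 1?eq_sym // -[X in X != _](tpermL i' i) (inj_eq perm_inj).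
rewrite -(card_imset _ (@permute_tuple_inj _ s)); apply/subset_leq_card/fintype.subsetP.
move=> _ /imsetP[u + ->]; rewrite !inE => /andP[uW uij].
have := permute_words s a u; rewrite !inE => ->.
by rewrite uW !tnth_mktuple si sj.
Qed.

(** Counts in two ways the words with a marked [p] and a marked [q]. All ordered pairs of distinct
    positions contribute equally, while each word has [a p * a q] markings; these use distinct
    positions because [p != q]. *)
Lemma card_words_at m a (p q : 'I_k) (i j : 'I_m) : p != q -> i != j ->
  (m * m.-1 * #|words_at a p q i j| = a p * a q * #|words m a|)%N.
Proof.
move=> pq ij.
transitivity (\sum_(i' < m) \sum_(j' < m | j' != i') #|words_at a p q i' j'|)%N.
  transitivity (\sum_(i' < m) \sum_(j' < m | j' != i') #|words_at a p q i j|)%N.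
    under eq_bigr => i' _.
      rewrite sum_nat_const.
      rewrite (_ : #|_| = m.-1); last by rewrite cardC1 card_ord.
    over.
    by rewrite sum_nat_const card_ord mulnA.
  apply: eq_bigr => i' _; apply: eq_bigr => j' ij'; rewrite eq_sym in ij'.
  by apply/eqP; rewrite eqn_leq !card_words_at_le.
transitivity (\sum_(u in words m a) (a p * a q))%N; last first.
  by rewrite sum_nat_const mulnC.
transitivity (\sum_(i' < m) \sum_(j' < m | j' != i')
    \sum_(u in words m a) ((tnth u i' == p) * (tnth u j' == q)))%N.
  apply: eq_bigr => i' _; apply: eq_bigr => j' _.
  rewrite -sum1dep_card big_mkcondr; apply: eq_bigr => u _.
  by do 2 case: eqP.
transitivity (\sum_(i' < m) \sum_(u in words m a)
    \sum_(j' < m | j' != i') ((tnth u i' == p) * (tnth u j' == q)))%N.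
  by apply: eq_bigr => i' _; rewrite exchange_big.
rewrite exchange_big; apply: eq_bigr => u /wordsP h.
rewrite -!h !count_memE big_distrl /=; apply: eq_bigr => i' _.
rewrite big_distrr /= big_mkcond; apply: eq_bigr => j' _.
case: (eqVneq j' i') => [->|//] /=.
by case: (eqVneq (tnth u i') p) => [->|//]; rewrite (negPf pq).
Qed.

End Words.

(** * Edges of the sort graph as words with a marked ascent *)

Definition swap_at m (t : 'I_m * 'I_m * m.-tuple 'I_3) :=
  (t.2, permute_tuple (tperm t.1.1 t.1.2) t.2).

Definition ascents m (V : {set m.-tuple 'I_3}) : {set 'I_m * 'I_m * m.-tuple 'I_3} :=
  [set t : 'I_m * 'I_m * m.-tuple 'I_3 | (t.1.2 == t.1.1.+1 :> nat) &&
    ((t.2 \in V) && (tnth t.2 t.1.1 < tnth t.2 t.1.2)%N)].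

(** Two ascents of one word never give the same edge: if [j < j'], the swap at [j] changes the
    letter at [j], whereas the swap at [j'] leaves it alone. *)
Lemma swap_at_inj m (V : {set m.-tuple 'I_3}) :
  {in ascents V &, injective (@swap_at m)}.
Proof.
have aux (j k j' k' : 'I_m) (u : m.-tuple 'I_3) :
    (k = j.+1 :> nat) -> (k' = j'.+1 :> nat) ->
    (tnth u j < tnth u k)%N -> (j < j')%N ->
    permute_tuple (tperm j k) u <> permute_tuple (tperm j' k') u.
  move=> kj kj' ujk jj' /(congr1 (fun w => tnth w j)).
  rewrite !tnth_mktuple tpermL tpermD; first by move=> e; rewrite e ltnn in ujk.
    by rewrite -(inj_eq val_inj) gtn_eqF.
  by rewrite -(inj_eq val_inj) /= kj' gtn_eqF // ltnW.
move=> [[j k] u] [[j' k'] u']; rewrite !inE /= => /and3P[/eqP kj _ ujk].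
move=> /and3P[/eqP kj' _ ujk'] [] uu'; rewrite -{}uu' in ujk' * => e0.
have e : permute_tuple (tperm j k) u = permute_tuple (tperm j' k') u by exact: val_inj.
have jj' : j = j'.
  apply: val_inj; case: (ltngtP j j') => // lt.
    by have := aux _ _ _ _ u kj kj' ujk lt e.
  by have := aux _ _ _ _ u kj' kj ujk' lt (esym e).
by rewrite jj'; congr (_, _, _); apply: val_inj; rewrite /= kj kj' jj'.
Qed.

Definition content3 (a b c : nat) (x : 'I_3) : nat := nth 0 [:: a; b; c] x.

Lemma sort_verticesE a b c : sort_vertices a b c = words (a + b + c) (content3 a b c).
Proof.
apply/setP => u; rewrite inE; apply/and3P/wordsP => [[h0 h1 h2] x|h].
  transitivity (count (fun y : 'I_3 => y == x :> nat) u); first exact: eq_count.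
  by case: x => -[|[|[|i]]] i3 //=; apply/eqP; rewrite ?h0 ?h1 ?h2.
have h' (x : 'I_3) : count (fun y : 'I_3 => y == x :> nat) u == content3 a b c x.
  by rewrite -h; apply/eqP/eq_count.
split; [exact: (h' (@Ordinal 3 0 isT)) | exact: (h' (@Ordinal 3 1 isT)) |].
exact: (h' (@Ordinal 3 2 isT)).
Qed.

(** E a b c : The target of a swap is automatically a vertex, since permuting positions preserves
    letter counts. *)
Lemma sort_edgesE a b c :
  sort_edges a b c = @swap_at _ @: ascents (sort_vertices a b c).
Proof.
apply/setP => -[u v]; apply/idP/imsetP.
  rewrite inE /= => /and3P[uV _ /existsP[j /existsP[k /and3P[kj ujk /eqP ->]]]].
  by exists (j, k, u); rewrite ?inE /= ?kj //; rewrite inE in uV; rewrite uV ujk.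
move=> [[[j k] w]]; rewrite !inE /= => /and3P[kj wV wjk] [-> ->].
have wV' : w \in sort_vertices a b c by rewrite inE.
have : permute_tuple (tperm j k) w \in sort_vertices a b c.
  by rewrite sort_verticesE permute_words -sort_verticesE.
rewrite inE wV => -> /=; apply/existsP; exists j; apply/existsP; exists k.
by rewrite kj wjk eqxx.
Qed.

Lemma card_ascents_at m (V : {set m.-tuple 'I_3}) (j k : 'I_m) :
  #|[set u in V | (tnth u j < tnth u k)%N]| =
  (\sum_(p < 3) \sum_(q < 3 | (p < q)%N)
    #|[set u in V | (tnth u j == p) && (tnth u k == q)]|)%N.
Proof.
rewrite -sum1_card (partition_big (fun u => tnth u j) predT) //=.
apply: eq_bigr => p _.
rewrite (partition_big (fun u => tnth u k) (fun q : 'I_3 => p < q)%N) /=; last first.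
  by move=> u /andP[]; rewrite inE => /andP[_ +] /eqP <-.
apply: eq_bigr => q pq; rewrite sum1dep_card; apply: eq_card => u; rewrite !inE.
case: (u \in V) => //=.
by case: eqVneq => [->|_]; case: eqVneq => [->|_]; rewrite ?pq ?andbF.
Qed.

Lemma card_succ_pairs m :
  #|[pred t : 'I_m * 'I_m | t.2 == t.1.+1 :> nat]| = m.-1.
Proof.
case: m => [|m]; first by apply: eq_card0 => -[[]].
pose f (i : 'I_m) := (widen_ord (leqnSn m) i, lift ord0 i).
have f_inj : injective f by move=> i j [] ij _; exact: val_inj.
rewrite -[RHS](card_ord m) -(card_codom f_inj); apply: eq_card => -[j k].
rewrite inE /=; apply/eqP/codomP => [kj|[i [-> ->]] //].
have jm : j < m by rewrite -ltnS -kj.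
by exists (Ordinal jm); congr (_, _); apply: val_inj.
Qed.

(** Each of the three letter pairs [p < q] occupies two given positions in a fraction
    [n^2 / (3n (3n - 1))] of the words, so an adjacent pair is an ascent with frequency
    [n / (3n - 1)]. There are [3n - 1] adjacent pairs. *)
Lemma card_sort_edges_square n :
  #|sort_edges n n n| = (n * #|sort_vertices n n n|)%N.
Proof.
rewrite sort_edgesE card_in_imset; last exact: swap_at_inj.
set V := sort_vertices n n n.
(* The factors [3n] and [3n - 1] are cancelled below and must be positive. *)
case: (posnP n) => [n0|n0].
  have -> : (n * #|V|)%N = 0%N by rewrite {1}n0 mul0n.
  by apply: eq_card0 => -[[[i i_lt] ?] ?]; exfalso; move: i_lt; rewrite n0.
have content_n x : content3 n n n x = n by case: x => -[|[|[|]]].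
have at_n (j k : 'I_(n + n + n)) : j != k ->
    ((3 * n).-1 * #|[set u in V | (tnth u j < tnth u k)%N]| = n * #|V|)%N.
  move=> jk; apply/eqP.
  rewrite -(eqn_pmul2l (_ : 0 < 3 * n)%N); last by rewrite muln_gt0.
  apply/eqP; rewrite card_ascents_at mulnA big_distrr /=.
  transitivity (\sum_(p < 3) \sum_(q < 3 | (p < q)%N) (n * n * #|V|))%N.
    apply: eq_bigr => p _; rewrite big_distrr /=; apply: eq_bigr => q pq.
    have pq' : p != q by rewrite -(inj_eq val_inj) ltn_eqF.
    have := card_words_at (content3 n n n) pq' jk.
    have -> : (3 * n = n + n + n)%N by lia.
    rewrite !content_n -sort_verticesE -/V.
    by rewrite /words_at -sort_verticesE.
  transitivity (3 * (n * n * #|V|))%N; last by rewrite !mulnA.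
  move: (n * n * #|V|)%N => c.
  under eq_bigr do rewrite big_mkcond !big_ord_recl big_ord0 /=.
  rewrite !big_ord_recl big_ord0 /=. lia.
apply/eqP; rewrite -(eqn_pmul2l (_ : 0 < (3 * n).-1)%N); last by lia.
have -> : #|ascents V| = (\sum_(t : 'I_(n + n + n) * 'I_(n + n + n) |
    t.2 == t.1.+1 :> nat) #|[set u in V | (tnth u t.1 < tnth u t.2)%N]|)%N.
  under [RHS]eq_bigr => t _ do rewrite -sum1dep_card.
  by rewrite pair_big_dep -sum1dep_card.
rewrite big_distrr /=; apply/eqP.
transitivity (\sum_(t : 'I_(n + n + n) * 'I_(n + n + n) | t.2 == t.1.+1 :> nat)
    (n * #|V|))%N.
  apply: eq_bigr => -[j k] /= /eqP kj; apply: at_n.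
  by rewrite -(inj_eq val_inj) /= kj ltn_eqF.
by rewrite sum_nat_const card_succ_pairs; congr (_.-1 * _)%N; lia.
Qed.

Local Open Scope classical_set_scope.
Local Open Scope ring_scope.

(** * Euler's product for the sine *)

Lemma Rintegral_is_derive (R : realType) (f F : R -> R) (a b : R) : a < b ->
  continuous f -> (forall x, is_derive x (1 : R) F (f x)) ->
  \int[lebesgue_measure]_(x in `[a, b]) f x = F b - F a.
Proof.
move=> ab cf dF.
have cF : continuous F.
  move=> x; apply: differentiable_continuous.
  exact/derivable1_diffP/(@ex_derive _ _ _ _ _ _ _ (dF x)).
rewrite /Rintegral (continuous_FTC2 (F := F) ab) //.
- exact: continuous_subspaceT.
- split; first by move=> x _; exact: (@ex_derive _ _ _ _ _ _ _ (dF x)).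
  + exact: cvg_at_right_filter (cF _).
  + exact: cvg_at_left_filter (cF _).
- by move=> x _; rewrite derive1E; exact: (@derive_val _ _ _ _ _ _ _ (dF x)).
Qed.

Lemma continuous_integrable_itv (R : realType) (f : R -> R) (a b : R) :
  continuous f -> lebesgue_measure.-integrable `[a, b]%classic (EFin \o f).
Proof.
move=> cf; apply: continuous_compact_integrable; first exact: segment_compact.
exact: continuous_subspaceT.
Qed.

(** * Recursion and bounds for the cosine integrals *)

Section CosineIntegrals.
Context {R : realType}.
Implicit Types (c t : R) (n : nat).

(** At [c = 0] this is Wallis's integral. *)
Definition cos_integral c n : R :=
  \int[lebesgue_measure]_(t in `[0, pi / 2]) (cos (c * t) * cos t ^+ n).

Lemma pihalf_gt0 : 0 < pi / 2 :> R.
Proof. by rewrite divr_gt0 ?pi_gt0. Qed.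

Lemma is_derive_cosM c t :
  is_derive t (1 : R) (fun u => cos (c * u)) (- c * sin (c * t)).
Proof.
have h : is_derive t 1 (fun u : R => c * u) c.
  by apply: is_derive_eq; exact: mulr1.
rewrite mulNr mulrC -mulNr.
exact: (@is_derive1_comp _ cos (fun u => c * u) _ _ _ (is_derive_cos _) h).
Qed.

Lemma is_derive_sinM c t :
  is_derive t (1 : R) (fun u => sin (c * u)) (c * cos (c * t)).
Proof.
have h : is_derive t 1 (fun u : R => c * u) c.
  by apply: is_derive_eq; exact: mulr1.
rewrite mulrC.
exact: (@is_derive1_comp _ sin (fun u => c * u) _ _ _ (is_derive_sin _) h).
Qed.

Lemma continuous_cosMX c n : continuous (fun t => cos (c * t) * cos t ^+ n).
Proof.
move=> t; apply: cvgM.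
  apply: (@continuous_comp _ _ _ (fun u => c * u) cos); last exact: continuous_cos.
  exact: mulrl_continuous.
apply: (@continuous_comp _ _ _ cos (fun u => u ^+ n)); first exact: continuous_cos.
exact: exprn_continuous.
Qed.

Lemma cos_integralSS c n :
  (n.+2%:R ^+ 2 - c ^+ 2) * cos_integral c n.+2 =
  n.+2%:R * n.+1%:R * cos_integral c n.
Proof.
(* [F] collects the boundary terms of two integrations by parts. Its derivative is [f], the mixed
   sine terms cancelling, and it vanishes at [0] through the sines and at [pi / 2] through the
   powers of cosine. *)
pose F t := c * (sin (c * t) * cos t ^+ n.+2)
            - n.+2%:R * (cos (c * t) * cos t ^+ n.+1 * sin t).
pose f t := n.+2%:R * n.+1%:R * (cos (c * t) * cos t ^+ n)
            - (n.+2%:R ^+ 2 - c ^+ 2) * (cos (c * t) * cos t ^+ n.+2).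
have cZ a m : continuous (fun t => a * (cos (c * t) * cos t ^+ m)).
  by move=> t; apply: cvgM; [exact: cvg_cst|exact: continuous_cosMX].
have cf : continuous f by move=> t; apply: cvgB; exact: cZ.
have dF t : is_derive t (1 : R) F (f t).
  have hK := is_derive_cosM c t; have hS := is_derive_sinM c t.
  have hX m := is_deriveX m (is_derive_cos t).
  have D := is_deriveB (is_deriveZ c (is_deriveM hS (hX n.+2)))
    (is_deriveZ n.+2%:R (is_deriveM (is_deriveM hK (hX n.+1)) (is_derive_sin t))).
  move: D; set d := (X in is_derive _ _ _ X) => D.
  have -> : f t = d.
    rewrite /f /d !fctE /GRing.scale /= !exprS.
    ring: (sin2cos2 t).
  have -> // : F = c *: ((fun u : R => sin (c * u)) * cos ^+ n.+2) - n.+2%:R *: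
    ((fun u : R => cos (c * u)) * cos ^+ n.+1 * sin).
  by apply/funext => u; rewrite /F !fctE.
have := Rintegral_is_derive pihalf_gt0 cf dF.
rewrite RintegralB //; [|exact: continuous_integrable_itv (cZ _ _)..].
rewrite !RintegralZl //; [|exact: continuous_integrable_itv (@continuous_cosMX _ _)..].
rewrite -!/(cos_integral _ _) /F cos_pihalf sin0 !mulr0 sin0 !expr0n /=.
rewrite !(mul0r, mulr0, subrr) => /eqP; rewrite subr_eq0 => /eqP <- //.
Qed.

Lemma cos_integral_bounds c n : 0 <= c <= 1 ->
  cos_integral 0 n.+2 <= cos_integral c n <= cos_integral 0 n.
Proof.
move=> /andP[c0 c1].
have cf a m := continuous_integrable_itv 0 (pi / 2) (@continuous_cosMX a m).
apply/andP; split; last first.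
  apply: le_Rintegral => //= t; rewrite in_itv /= => /andP[t0 tpi].
  rewrite mul0r cos0 ler_wpM2r ?cos_le1 // exprn_ge0 // cos_ge0_pihalf // tpi.
  by rewrite (le_trans _ t0) // oppr_le0 ltW ?pihalf_gt0.
apply: le_Rintegral => //= t; rewrite in_itv /= => /andP[t0 tpi].
have tpi' : t <= pi.
  by rewrite (le_trans tpi) // ler_pdivrMr // ler_peMr ?pi_ge0 // ler1n.
have ct0 : 0 <= cos t.
  by rewrite cos_ge0_pihalf // tpi (le_trans _ t0) // oppr_le0 ltW ?pihalf_gt0.
rewrite mul0r cos0 !mul1r !exprS mulrA.
rewrite ler_wpM2r ?exprn_ge0 //.
have ctt : c * t <= t by rewrite ler_piMl.
(* Cosine decreases on [[0, pi]] and [0 <= c t <= t]. *)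
have : cos t <= cos (c * t).
  rewrite leNgt ltr_cos -?leNgt //; rewrite in_itv /= ?t0 //.
  by rewrite mulr_ge0 // (le_trans ctt).
have := cos_le1 t; nra.
Qed.

Lemma cos_integral00 : cos_integral 0 0 = pi / 2.
Proof.
have dF t : is_derive t (1 : R) id (cos (0 * t) * cos t ^+ 0).
  by rewrite mul0r cos0 mul1r; exact: is_derive_id.
rewrite /cos_integral (Rintegral_is_derive pihalf_gt0 _ dF) ?subr0 //.
exact: continuous_cosMX.
Qed.

Lemma cos_integral_n0 c : c != 0 -> cos_integral c 0 = sin (c * (pi / 2)) / c.
Proof.
move=> c0; have dF t : is_derive t (1 : R) (fun u => c^-1 * sin (c * u))
    (cos (c * t) * cos t ^+ 0).
  have D := is_deriveZ c^-1 (is_derive_sinM c t).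
  by rewrite expr0 mulr1 -[cos _](mulKf c0).
rewrite /cos_integral (Rintegral_is_derive pihalf_gt0 _ dF).
  by rewrite mulr0 sin0 mulr0 subr0 mulrC.
exact: continuous_cosMX.
Qed.

Lemma cos_integral0SS n :
  n.+2%:R * cos_integral 0 n.+2 = n.+1%:R * cos_integral 0 n.
Proof.
have n2 : n.+2%:R != 0 :> R by rewrite pnatr_eq0.
apply: (mulfI n2); have := cos_integralSS 0 n.
by rewrite expr0n subr0 expr2 !mulrA.
Qed.

Lemma cos_integral0_gt0 n : 0 < cos_integral 0 n.*2.
Proof.
elim: n => [|n IH]; first by rewrite cos_integral00 pihalf_gt0.
have n2 : 0 < n.*2.+2%:R :> R by rewrite ltr0n.
by rewrite doubleS -(pmulr_rgt0 _ n2) cos_integral0SS mulr_gt0.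
Qed.

(* The recursions for [c] and for [0] differ exactly by the factors of the product. *)
Lemma cos_integral_prod c n : 0 <= c <= 1 ->
  cos_integral c n.*2 * \prod_(k < n) (1 - (c / 2) ^+ 2 / k.+1%:R ^+ 2) * (pi / 2) =
  cos_integral 0 n.*2 * cos_integral c 0.
Proof.
move=> c01; elim: n => [|n IH].
  by rewrite big_ord0 mulr1 cos_integral00 mulrC.
rewrite doubleS big_ord_recr /=.
have Hc := cos_integralSS c n.*2; have H0 := cos_integral0SS n.*2.
move: (cos_integral c _.+2) (cos_integral 0 _.+2) Hc H0 => x y Hc H0.
have n1 : n.+1%:R != 0 :> R by rewrite pnatr_eq0.
have n2 : n.*2.+2%:R = 2 * n.+1%:R :> R by rewrite -natrM mul2n doubleS.
rewrite n2 in Hc H0.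
have n21 : 2 * n.+1%:R != 0 :> R by rewrite mulf_neq0 ?pnatr_eq0.
(* One factor [2(n + 1)] serves the recursion for [0]. A second one serves the recursion for [c],
   whose coefficient [4(n + 1)^2 - c^2] is [4(n + 1)^2] times the new factor of the product. *)
apply: (mulfI n21); rewrite [RHS]mulrA H0 -[RHS]mulrA -IH.
apply: (mulfI n21).
move: (\prod_(k < n) _) => P.
have -> : 2 * n.+1%:R * (n.*2.+1%:R * (cos_integral c n.*2 * P * (pi / 2))) =
    (2 * n.+1%:R * n.*2.+1%:R * cos_integral c n.*2) * P * (pi / 2) :> R by ring.
rewrite -Hc; field.
by [].
Qed.

End CosineIntegrals.

Lemma euler_sine_product (R : realType) (x : R) : 0 < x <= 1 / 2 ->
  (fun n => \prod_(k < n) (1 - x ^+ 2 / k.+1%:R ^+ 2)) @ \oo -->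
  sin (pi * x) / (pi * x).
Proof.
(* The bound [x <= 1 / 2] gives [c <= 1], as the comparison of integrals requires. *)
move=> /andP[x0 x1]; pose c := 2 * x.
have c0 : c != 0 by rewrite mulf_neq0 ?pnatr_eq0 ?gt_eqF.
have c01 : 0 <= c <= 1 by rewrite /c; lra.
have cx : c / 2 = x by rewrite /c mulrC mulKf ?pnatr_eq0.
pose r n : R := cos_integral c n.*2 / cos_integral 0 n.*2.
have r1 : r n @[n --> \oo] --> (1 : R).
  (* The lower bound is the ratio [(2n + 1) / (2n + 2)] of consecutive even Wallis integrals. *)
  apply: (@squeeze_cvgr _ _ _ _ (fun n => 1 - (n.*2.+2%:R)^-1) (fun=> 1)).
  - near=> n; have I0 := cos_integral0_gt0 (R := R) n.
    have := cos_integral_bounds n.*2 c01.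
    rewrite /r ler_pdivlMr // ler_pdivrMr // mul1r.
    move=> /andP[h ->]; rewrite andbT (le_trans _ h) // le_eqVlt.
    have n2 : n.*2.+2%:R != 0 :> R by rewrite pnatr_eq0.
    apply/orP; left; apply/eqP/(mulfI n2); rewrite cos_integral0SS.
    by rewrite mulrA mulrBr mulfV // mulr1 -[in LHS]addn1 natrD addrK.
  - rewrite -[X in _ --> X]subr0; apply: cvgB; first exact: cvg_cst.
    have -> : (fun n => n.*2.+2%:R^-1) = (fun n => 2^-1 * harmonic n) :> (nat -> R).
      by apply/funext => n; rewrite /harmonic /= -invfM -natrM mul2n doubleS.
    rewrite -[X in _ --> X](mulr0 2^-1).
    by apply: cvgM; [exact: cvg_cst | exact: cvg_harmonic].
  - exact: cvg_cst.
have Ic n : cos_integral c n.*2 != 0.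
  have /andP[h _] := cos_integral_bounds n.*2 c01.
  by rewrite gt_eqF // (lt_le_trans _ h) // -doubleS cos_integral0_gt0.
have I0 n : cos_integral 0 n.*2 != 0 :> R by rewrite gt_eqF ?cos_integral0_gt0.
(* The product formula solved for the partial product: the limit value appears exactly, with
   [1 / r n] as the only varying factor. *)
have -> : (fun n => \prod_(k < n) (1 - x ^+ 2 / k.+1%:R ^+ 2)) =
    (fun n => sin (pi * x) / (pi * x) * (r n)^-1).
  apply/funext => n; have := cos_integral_prod n c01; rewrite cx cos_integral_n0 // /r.
  have -> : c * (pi / 2) = pi * x by rewrite -cx; field.
  have p0 : pi != 0 :> R by rewrite gt_eqF ?pi_gt0.
  move: (pi : R) p0 => p p0 H; rewrite -cx in H *.
  have p2 : p / 2 != 0 by rewrite mulf_neq0 ?invr_eq0 ?pnatr_eq0.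
  apply: (mulfI (mulf_neq0 (Ic n) p2)); rewrite mulrAC H; field.
  by rewrite c0 p0 Ic I0.
have rV : (r n)^-1 @[n --> \oo] --> (1 : R).
  by rewrite -[X in _ --> X]invr1; apply: cvgV => //; exact: oner_neq0.
by rewrite -[X in _ --> X]mulr1; apply: cvgM rV; exact: cvg_cst.
Unshelve. all: by end_near.
Qed.

(** * Asymptotics of the cost *)

(** The source of the square root of 3 in the asymptotic constant, through Euler's product at
    [x = 1/3]. *)
Lemma sin_pi_third (R : realType) : sin (pi / 3) = Num.sqrt 3 / 2 :> R.
Proof.
have pi0 := pi_gt0 R.
have s0 : 0 < sin (pi / 3) :> R.
  by apply: sin_gt0_pi; rewrite divr_gt0 //= ltr_pdivrMr // ltr_pMr // ltr1n.
(* [sin (2 pi / 3) = sin (pi / 3)] *)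
have c2 : cos (pi / 3) = 2^-1 :> R.
  have : sin ((pi / 3) *+ 2) = sin (pi / 3) :> R.
    have -> : (pi / 3) *+ 2 = pi - pi / 3 :> R by move: (pi : R) => p; field.
    by rewrite sinB sinpi cospi mul0r mulN1r sub0r opprK.
  rewrite sin_mulr2n => e; apply: (mulIf (lt0r_neq0 s0)); move: e.
  by move: (sin _) (cos _) => s c; lra.
apply/eqP; rewrite -(eqrXn2 (_ : 0 < 2)%N) ?(ltW s0) ?divr_ge0 ?sqrtr_ge0 //.
by rewrite sin2cos2 c2 expr_div_n sqr_sqrtr //; apply/eqP; field.
Qed.

(** Induction on [n]. With [k = n + 1], the left side grows by [3k (3k - 1) (3k - 2) / k^3]. The new
    factor of the product is [(3k - 1) (3k + 1) / (9 k^2)], and the prefactor trades [3k + 1] for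
    [3k - 2]. *)
Lemma trinomialE (R : realType) n :
  ((3 * n)`!)%:R / (n`!)%:R ^+ 3 =
  27 ^+ n / (3 * n + 1)%:R * \prod_(k < n) (1 - (1 / 3) ^+ 2 / k.+1%:R ^+ 2) :> R.
Proof.
elim: n => [|n IH]; first by rewrite big_ord0 muln0 fact0 !expr1n expr0 !divr1 mulr1.
rewrite big_ord_recr /= [27 ^+ n.+1]exprS.
have -> : (3 * n.+1 = (3 * n).+3)%N by lia.
rewrite !factS !natrM.
have n1 : n.+1%:R != 0 :> R by rewrite pnatr_eq0.
have f1 : n`!%:R != 0 :> R by rewrite pnatr_eq0 -lt0n fact_gt0.
have a1 : (3 * n + 1)%:R != 0 :> R by rewrite pnatr_eq0 addn1.
have -> : (3 * n).+3%:R * ((3 * n).+2%:R * ((3 * n).+1%:R * (3 * n)`!%:R)) /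
      (n.+1%:R * n`!%:R) ^+ 3 =
    (3 * n).+3%:R * ((3 * n).+2%:R * (3 * n).+1%:R) / n.+1%:R ^+ 3 *
      ((3 * n)`!%:R / n`!%:R ^+ 3) :> R.
  move: ((3 * n).+3%:R : R) ((3 * n).+2%:R : R) ((3 * n).+1%:R : R) => u3 u2 u1.
  move: ((3 * n)`!%:R : R) (n.+1%:R : R) (n`!%:R : R) n1 f1 => u0 x y x0 y0.
  by field; rewrite x0 y0.
rewrite IH; move: (\prod_(k < n) _) => P; move: (27 ^+ n) => Q.
(* Everything is rewritten in the single variable [x = n + 1], leaving a rational identity. *)
have e k : (3 * n + k)%:R = 3 * n.+1%:R + k%:R - 3 :> R.
  by rewrite natrD natrM -[n.+1]addn1 natrD; ring.
have -> : ((3 * n).+3 + 1 = 3 * n + 4)%N by lia.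
have a4 : (3 * n + 4)%:R != 0 :> R by rewrite pnatr_eq0 addnS.
rewrite -[(3 * n).+3]addn3 -[(3 * n).+2]addn2 -[(3 * n).+1]addn1.
rewrite !e in a1 a4 *; move: (n.+1%:R : R) n1 a1 a4 => x n1 a1 a4.
field.
by rewrite n1 a1 a4.
Qed.

Lemma enum_cost_trinomial (R : realType) n :
  (enum_cost n n n n)%:R = n%:R ^+ 2 * ((3 * n)`!)%:R / (n`!)%:R ^+ 3 :> R.
Proof.
have f1 : n`!%:R != 0 :> R by rewrite pnatr_eq0 -lt0n fact_gt0.
have content_n x : content3 n n n x = n by case: x => -[|[|[|]]].
have := @card_words 3 (n + n + n) (content3 n n n).
rewrite -sort_verticesE => H.
have {}H : (#|sort_vertices n n n| * n`! ^ 3 = (3 * n)`!)%N.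
  rewrite -[(3 * n)%N](_ : n + n + n = _)%N; last by lia.
  rewrite -H; last first.
    by under eq_bigr do rewrite content_n; rewrite sum_nat_const card_ord; lia.
  by under eq_bigr do rewrite content_n; rewrite prod_nat_const card_ord.
rewrite /enum_cost card_sort_edges_square -H !natrM.
by field.
Qed.

Lemma enum_cost_equiv (R : realType) :
  (fun n : nat => (enum_cost n n n n)%:R /
          (n%:R * Num.sqrt 3 / (2 * pi) * 3 ^+ (3 * n)) : R) @ \oo --> (1 : R).
Proof.
have s3 : Num.sqrt 3 != 0 :> R by rewrite gt_eqF // sqrtr_gt0.
have p0 : pi != 0 :> R by rewrite gt_eqF ?pi_gt0.
(* Shifting the index avoids [n = 0], where the ratio has a zero denominator. *)
rewrite -(cvg_shiftS _).
pose P n : R := \prod_(k < n) (1 - (1 / 3) ^+ 2 / k.+1%:R ^+ 2).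
pose r n : R := n%:R / (3 * n + 1)%:R.
have rl : r n.+1 @[n --> \oo] --> (3^-1 : R).
  have -> : (fun n => r n.+1) = (fun n => (3 + harmonic n)^-1).
    apply/funext => n; rewrite /r /harmonic /= natrD natrM.
    have n1 : n.+1%:R != 0 :> R by rewrite pnatr_eq0.
    have a1 : 3 * n.+1%:R + 1 != 0 :> R by rewrite -natrM natr1 pnatr_eq0.
    by move: (n.+1%:R : R) n1 a1 => x n1 a1; field; rewrite n1 a1.
  apply: cvgV; first by rewrite pnatr_eq0.
  by rewrite -[X in _ --> X]addr0; apply: cvgD; [exact: cvg_cst|exact: cvg_harmonic].
have Pl : P n.+1 @[n --> \oo] --> (sin (pi * (1 / 3)) / (pi * (1 / 3)) : R).
  rewrite (cvg_shiftS P); apply: euler_sine_product; lra.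
have -> : (fun n => (enum_cost n.+1 n.+1 n.+1 n.+1)%:R /
      (n.+1%:R * Num.sqrt 3 / (2 * pi) * 3 ^+ (3 * n.+1))) =
    (fun n => r n.+1 * P n.+1 * (2 * pi / Num.sqrt 3)).
  apply/funext => n; rewrite enum_cost_trinomial -mulrA trinomialE -/(P n.+1).
  have n1 : n.+1%:R != 0 :> R by rewrite pnatr_eq0.
  have a1 : (3 * n.+1 + 1)%:R != 0 :> R by rewrite pnatr_eq0 addn1.
  rewrite /r exprM (_ : 3 ^+ 3 = 27); last by ring.
  have q0 : 27 ^+ n.+1 != 0 :> R by rewrite expf_neq0 // pnatr_eq0.
  move: (27 ^+ n.+1) (n.+1%:R) ((3 * n.+1 + 1)%:R) q0 n1 a1 => q x y q0 n1 a1.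
  move: (Num.sqrt 3) pi (P n.+1) s3 p0 => s p Pn s3 p0.
  by field; rewrite q0 n1 a1 s3 p0.
(* The limits of [n / (3n + 1)] and of the product cancel the constant of the claimed equivalent. *)
have L1 : 3^-1 * (sin (pi * (1 / 3)) / (pi * (1 / 3))) * (2 * pi / Num.sqrt 3) = 1 :> R.
  rewrite mul1r sin_pi_third.
  move: (Num.sqrt 3 : R) (pi : R) s3 p0 => s p s3 p0; field.
  by rewrite s3 p0.
have := cvgM (cvgM rl Pl) (cvg_cst (2 * pi / Num.sqrt 3 : R)).
by rewrite L1 => L; exact: L.
Qed.

(** * Bound in terms of the number of tiles *)

Lemma tile_count_diag n : tile_count n n n n = (6 * n ^ 2)%N.
Proof. rewrite /tile_count; lia. Qed.

(** In the product formula, [1 / (3n + 1)] and all the factors of the product lie between 0 and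
    1. *)
Lemma trinomial_le (R : realType) n : ((3 * n)`!)%:R / (n`!)%:R ^+ 3 <= 27 ^+ n :> R.
Proof.
rewrite trinomialE -mulrA ler_piMr ?exprn_ge0 //.
rewrite mulrC ler_pdivrMr ?ltr0n ?addn1 // (@le_trans _ _ 1) ?mul1r ?ler1n //.
apply: Num.Theory.prodr_ile1 => k _.
have k1 : 1 <= k.+1%:R ^+ 2 :> R by rewrite exprn_ege1 // ler1n.
have k2 : (k.+1%:R ^+ 2)^-1 <= 1 :> R by rewrite invf_le1 // (lt_le_trans ltr01).
have k3 : 0 <= (k.+1%:R ^+ 2)^-1 :> R by rewrite invr_ge0 (le_trans ler01).
by move: (_^-1) k2 k3 => y k2 k3; lra.
Qed.

Lemma enum_cost_bigO (R : realType) :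
  exists2 gamma : R, 0 < gamma &
        (fun n : nat => (enum_cost n n n n)%:R : R) =O_\oo
        (fun n : nat => Num.sqrt (tile_count n n n n)%:R *
           expR (gamma * Num.sqrt (tile_count n n n n)%:R) : R).
Proof.
(* A crude constant, [28 = 27 + 1]: from [y <= 1 + y <= exp y] come [27^n <= exp (27 n)] and
   [n <= exp n], so [n^2 27^n <= n exp (28 n)]. Then [n] is replaced by the larger square root of
   [6 n^2]. *)
exists 28 => //; apply/eqO_exP; exists 1 => //; near=> n; rewrite mul1r.
have nN : n%:R <= Num.sqrt (tile_count n n n n)%:R :> R.
  rewrite tile_count_diag -[leLHS]ger0_norm // -sqrtr_sqr ler_wsqrtr // -natrX ler_nat.
  by rewrite leq_pmull.
rewrite !ger0_norm ?mulr_ge0 ?sqrtr_ge0 ?expR_ge0 //.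
rewrite (@le_trans _ _ (n%:R * expR (28 * n%:R))) //; last first.
  by rewrite ler_pM ?expR_ge0 // ler_expR ler_wpM2l.
rewrite enum_cost_trinomial -mulrA.
rewrite (le_trans (ler_wpM2l _ (trinomial_le R n))) ?exprn_ge0 //.
rewrite expr2 -mulrA ler_wpM2l // -[28]natr1 mulrDl mul1r expRD mulrC.
rewrite ler_pM ?exprn_ge0 //.
  rewrite mulrC expRM_natl lerXn2r ?nnegrE ?expR_ge0 //.
  by rewrite (le_trans _ (expR_ge1Dx _)) // lerDr.
by rewrite (le_trans _ (expR_ge1Dx _)) // lerDr.
Unshelve. all: by end_near.
Qed.

Theorem mainTheorem2 (R : realType) :
  [/\ forall n : nat, (1 <= n)%N ->
        (enum_cost n n n n)%:R =
          n%:R ^+ 2 * ((3 * n)`!)%:R / (n`!)%:R ^+ 3 :> R,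
      (fun n : nat => (enum_cost n n n n)%:R /
          (n%:R * Num.sqrt 3 / (2 * pi) * 3 ^+ (3 * n)) : R)
        @ \oo --> (1 : R),
      forall n : nat, (1 <= n)%N -> tile_count n n n n = (6 * n ^ 2)%N
    & exists2 gamma : R, 0 < gamma &
        (fun n : nat => (enum_cost n n n n)%:R : R) =O_\oo
        (fun n : nat => Num.sqrt (tile_count n n n n)%:R *
           expR (gamma * Num.sqrt (tile_count n n n n)%:R) : R)].
Proof.
split.
- by move=> n _; exact: enum_cost_trinomial.
- exact: enum_cost_equiv.
- by move=> n _; exact: tile_count_diag.
- exact: enum_cost_bigO.
Qed.
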